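(* Let $M\ge2$ and $n\ge2$ be integers, let $\delta\in(0,1)$, let $(\mathcal X,\mu)$ be a measure space, and let $\mathcal P=\{p_1,\dots,p_M\}$ be a set of probability densities on $\mathcal X$ with respect to $\mu$. There is a density estimator $\widehat p=\widehat p(X_1,\dots,X_n)$ such that for every probability density $p^\star$ on $(\mathcal X,\mu)$ (not assumed to belong to $\operatorname{conv}(\mathcal P)$), if $X_1,\dots,X_n$ are i.i.d. with density $p^\star$, then with probability at least $1-\delta$, $$\mathrm{KL}(p^\star,\widehat p)\le\inf_{p\in\operatorname{conv}(\mathcal P)}\mathrm{KL}(p^\star,p)+\frac{43M\log^2(3nM)+22\log(3nM)\log(1/\delta)}{n}.$$
   Context: $\operatorname{conv}(\mathcal P)$ is the set of mixtures $\sum_{j=1}^M\theta_jp_j$ with $\theta_j\ge0$, $\sum_j\theta_j=1$. For probability densities $p,q$ on $(\mathcal X,\mu)$, $\mathrm{KL}(p,q)=\int_{\mathcal X}p\log(p/q)\,d\mu\in[0,+\infty]$ (equal to $+\infty$ if $p$ is not absolutely continuous with respect to $q$). A density estimator is a map from samples in $\mathcal X^n$ to probability densities on $(\mathcal X,\mu)$; it may depend on $\mathcal P$, $n$, $\delta$, but not on $p^\star$. $\log$ is the natural logarithm and $\log^2(x)=(\log x)^2$. *)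

(* Defs.v *)
(* MathComp-Analysis. *)
From HB Require Import structures.
From mathcomp Require Export all_boot all_order all_algebra.
From mathcomp Require Export all_classical all_reals all_analysis.

Set Implicit Arguments.
Unset Strict Implicit.
Unset Printing Implicit Defensive.

Import Order.TTheory GRing.Theory Num.Theory.
Import numFieldNormedType.Exports.

Local Open Scope classical_set_scope.
Local Open Scope ring_scope.

Definition density d (T : measurableType d) (R : realType)
    (mu : {measure set T -> \bar R}) (p : T -> R) : Prop :=
  [/\ measurable_fun setT p, forall x, 0 <= p x &
      (\int[mu]_x (p x)%:E = 1)%E].

Definition density_measure d (T : measurableType d) (R : realType)
    (mu : {measure set T -> \bar R}) (p : T -> R) (A : set T) : \bar R :=
  (\int[mu]_(x in A) (p x)%:E)%E.

Definition mixtures (T : Type) (R : realType) (M : nat) (p : 'I_M -> T -> R) :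
    set (T -> R) :=
  [set q | exists theta : 'I_M -> R,
     [/\ forall j, 0 <= theta j, \sum_(j < M) theta j = 1 &
         q = fun x => \sum_(j < M) theta j * p j x]].

(* For densities the negative part of the integrand has integral at most 1
   (p * ln (q / p) <= q - p), so the integral is always meaningful.  The
   integrand is 0 where p = 0; where q = 0 < p it takes the junk value
   p * ln 0 = 0, but this set is mu-null in the first branch. *)
Definition KL d (T : measurableType d) (R : realType)
    (mu : {measure set T -> \bar R}) (p q : T -> R) : \bar R :=
  if `[< density_measure mu p `<< density_measure mu q >]
  then (\int[mu]_x (p x * ln (p x / q x))%:E)%E
  else +oo%E.

(* phat s is the density estimated from the sample s.  As usual in statistics
   the estimator is a measurable function, jointly in (s, x). *)
Definition density_estimator d (T : measurableType d) (R : realType)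
    (mu : {measure set T -> \bar R}) (n : nat)
    (phat : n.-tuple T -> T -> R) : Prop :=
  (forall s, density mu (phat s)) /\
  measurable_fun setT (fun z : n.-tuple T * T => phat z.1 z.2).

Definition mutually_independent d d' (Omega : measurableType d')
    (T : measurableType d) (R : realType) (P : probability Omega R) (n : nat)
    (X : 'I_n -> {RV P >-> T}) : Prop :=
  forall (J : {set 'I_n}) (A : 'I_n -> set T),
    (forall i, i \in J -> measurable (A i)) ->
    (P (\bigcap_(i in [set` J]) X i @^-1` A i)
     = \prod_(i in J) P (X i @^-1` A i))%E.

Definition iid_with_density d d' (Omega : measurableType d')
    (T : measurableType d) (R : realType) (P : probability Omega R)
    (mu : {measure set T -> \bar R}) (p : T -> R) (n : nat)
    (X : 'I_n -> {RV P >-> T}) : Prop :=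
  mutually_independent X /\
  forall i A, measurable A -> distribution P (X i) A = density_measure mu p A.

(* Main.v *)
(* Empirical risk minimisation over a finite net of mixture weights.

   The net [net_weight] has at most (nM + 1) ^ M elements, all its weights are
   at least 1 / K with K = M (nM + 1), and every mixture is pointwise at most
   (1 + 1/n) times some mixture of the net.

   Let theta be nearly optimal for the true risk among all weights bounded below
   by 1 / K, and for a mixture of the net let D be the log-likelihood ratio of
   that mixture to the mixture of weights theta, so that |D| <= ln K and - E D
   is the excess risk.  As the class is convex, moving from theta towards the
   mixture cannot improve the risk, whence E (exp D) <= 1 + o(1).  The pointwise
   bound  - D <= a (1 - exp (D / 2)) ^ 2 + 1 - exp D,  with a of order ln K,
   turns this into  - E D <= 2 a (1 - E exp (D / 2)) + o(1).  If the mixture is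
   selected then sum_i D (X_i) >= -1, since the net contains a near-copy of
   theta; by Markov's inequality for prod_i exp (D (X_i) / 2) this has
   probability at most e ^ (1/2) (E exp (D / 2)) ^ n.  So a mixture whose excess
   risk exceeds the bound is selected with probability at most delta / N, where
   N is the size of the net; a union bound concludes. *)
Require Import Defs.
From mathcomp Require Import all_boot all_order all_algebra.
From mathcomp Require Import all_classical all_reals all_analysis.
From mathcomp Require Import measurable_realfun ring lra.
Set Implicit Arguments.
Unset Strict Implicit.
Unset Printing Implicit Defensive.
Import Order.TTheory GRing.Theory Num.Theory.
Import numFieldNormedType.Exports.
Local Open Scope classical_set_scope.
Local Open Scope ring_scope.

(** * Logarithm inequalities and integrals against a density *)

Lemma ln_ge1BV (R : realType) (x : R) : 0 < x -> 1 - x^-1 <= ln x.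
Proof.
move=> x0; have xV0 : 0 < x^-1 by rewrite invr_gt0.
have -> : ln x = - ln (1 + (x^-1 - 1)) by rewrite subrKC lnV ?posrE// opprK.
by rewrite -[leLHS]opprK lerN2 opprB le_ln1Dx//; lra.
Qed.

(** With u = 1 / (1 + y), [ln_ge1BV] gives ln (1 + y) >= 1 - u = y - u y^2, and u <= 2. *)
Lemma ln1D_ge_quadratic (R : realType) (y : R) :
  - 2^-1 <= y -> y - 2 * y ^+ 2 <= ln (1 + y).
Proof.
move=> y2; have y0 : 0 < 1 + y by lra.
apply: (le_trans _ (ln_ge1BV y0)).
set u := (1 + y)^-1.
have uE : u * (1 + y) = 1 by rewrite mulVf// gt_eqF.
have u0 : 0 < u by rewrite invr_gt0.
have u2 : u <= 2 by rewrite -[leRHS]invrK lef_pV2 ?posrE//; lra.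
have uy : u * y = 1 - u by rewrite -uE; ring.
have -> : 1 - u = y - u * y ^+ 2 by rewrite expr2 mulrA uy mulrBl uy; ring.
by have := sqr_ge0 y; nra.
Qed.

(** Put v = exp (z / 2). If v < 1/2, then (1 - v)^2 >= 1/4 and [- (4 * z) <= a] suffices. Otherwise
    w = 1 / v <= 2, and - z <= 2 (w - 1) = (2 w + 1) (1 - v)^2 + 1 - v^2 with 2 w + 1 <= 5 <= a. *)
Lemma excess_pointwise (R : realType) (a z : R) : 5 <= a -> - (4 * z) <= a ->
  - z <= a * (1 - expR (2^-1 * z)) ^+ 2 + 1 - expR z.
Proof.
move=> a5 za; set v := expR _.
have v0 : 0 < v by exact: expR_gt0.
have -> : expR z = v ^+ 2 by rewrite -expRM_natl; congr expR; field.
have [v2|v2] := lerP 2^-1 v; last first.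
  have : 4^-1 <= (1 - v) ^+ 2 by nra.
  have : v ^+ 2 <= 1 by nra.
  nra.
set w := expR (- (2^-1 * z)).
have vw : v * w = 1 by rewrite -expRD subrr expR0.
have w2 : w <= 2 by nra.
have zw : - z <= 2 * (w - 1).
  by have := expR_ge1Dx (- (2^-1 * z)); rewrite -/w; lra.
have E : 2 * (w - 1) = (1 - v) ^+ 2 * (2 * w + 1) + 1 - v ^+ 2.
  transitivity (2 * w - 4 * (v * w) + 2 * v * (v * w) + 2 - 2 * v); last by ring.
  by rewrite vw; ring.
have := sqr_ge0 (1 - v); nra.
Qed.

(** The reverse bound with [c'] is for the case a = 0: it forces b = 0, so that both logarithms take
    the default value 0. *)
Lemma ln_ratio_le (R : realType) (a b c c' : R) :
  0 <= a -> a <= c * b -> b <= c' * a -> 1 <= c -> ln a - ln b <= ln c.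
Proof.
move=> a0 ab ba c1; have c0 : 0 < c by exact: lt_le_trans c1.
have [aE|aN0] := eqVneq a 0.
  by rewrite aE mulr0 in ba *; rewrite (ln0 (lexx 0)) (ln0 ba) subrr ln_ge0.
have a1 : 0 < a by rewrite lt_neqAle eq_sym aN0.
have b0 : 0 < b by rewrite -(pmulr_rgt0 _ c0) (lt_le_trans a1).
by rewrite lerBlDr -lnM ?posrE// ler_ln ?posrE// mulr_gt0.
Qed.

(* If a = 0 then b = 0, and ln 0 = 0 makes expR (ln b - ln a) equal to 1. *)
Lemma ln_mix_ge (R : realType) (a b c l : R) :
    0 <= a -> 0 <= b -> a <= c * b -> b <= c * a -> 0 <= l <= 2^-1 ->
  l * (expR (ln b - ln a) - 1) - 2 * (l * (expR (ln b - ln a) - 1)) ^+ 2 <=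
  ln ((1 - l) * a + l * b) - ln a.
Proof.
move=> a0 b0 ab ba /andP[l0 l2].
have [aE|aN0] := eqVneq a 0.
  have -> : b = 0 by apply/eqP; rewrite eq_le b0 -(mulr0 c) -aE ba.
  by rewrite aE !mulr0 addr0 subrr expR0 subrr mulr0 expr0n/= mulr0 subrr.
have a1 : 0 < a by rewrite lt_neqAle eq_sym aN0.
have bN0 : b != 0.
  by apply: contra_neq aN0 => bE; apply/eqP; rewrite eq_le a0 -(mulr0 c) -bE ab.
have b1 : 0 < b by rewrite lt_neqAle eq_sym bN0.
rewrite expRB !lnK ?posrE//.
have r0 : 0 < b / a by rewrite divr_gt0.
have -> : (1 - l) * a + l * b = (1 + l * (b / a - 1)) * a by field.
by rewrite lnM ?posrE//; [rewrite addrK; apply: ln1D_ge_quadratic; nra|nra].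
Qed.

Lemma measure_le_sum (d : measure_display) (T : measurableType d)
    (R : realType) (mu : {measure set T -> \bar R}) (I : finType) (Q : pred I)
    (A : set T) (E : I -> set T) :
    measurable A -> (forall i, measurable (E i)) ->
    (forall x, A x -> exists2 i, Q i & E i x) ->
  (mu A <= \sum_(i | Q i) mu (E i))%E.
Proof.
move=> mA mE AE.
have mU : measurable (\big[setU/set0]_(i | Q i) E i).
  by apply: bigsetU_measurable => i _; exact: mE.
apply: (@le_trans _ _ (mu (\big[setU/set0]_(i | Q i) E i))).
  apply: le_measure; rewrite ?inE// => x /AE[i Qi Eix].
  by rewrite (bigD1 i)//=; left.
(* Measurability of the partial unions is carried through the induction, because subadditivity asks
   for it at each step. *)
suff [] : measurable (\big[setU/set0]_(i | Q i) E i) /\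
    (mu (\big[setU/set0]_(i | Q i) E i) <= \sum_(i | Q i) mu (E i))%E by [].
elim/big_rec2 : _ => [|i y A' Qi [mA' H]]; first by rewrite measure0.
split; first exact: measurableU.
by apply: (le_trans (measureU2 _ _ _)) => //; exact: leeD2l.
Qed.

(** Log-likelihood ratios of mixtures with weights bounded below are of this kind, and so are their
    exponentials; such functions are integrable against every density. *)
Definition bounded_measurable (R : realType) (d : measure_display)
    (T : measurableType d) (f : T -> R) :=
  measurable_fun setT f /\ exists c, forall x, `|f x| <= c.

Lemma density_integrable (R : realType) (d : measure_display)
    (T : measurableType d) (mu : {measure set T -> \bar R}) (p : T -> R) :
  density mu p -> mu.-integrable setT (EFin \o p).
Proof.
move=> [mp p0 p1]; apply/integrableP; split; first exact/measurable_EFinP.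
by under eq_integral do rewrite /= ger0_norm//; rewrite p1 ltry.
Qed.

Lemma density_integrableM (R : realType) (d : measure_display)
    (T : measurableType d) (mu : {measure set T -> \bar R}) (p f : T -> R) :
  density mu p -> bounded_measurable f ->
  mu.-integrable setT (EFin \o (fun x => p x * f x)).
Proof.
move=> hp [mf [c fc]]; have [mp p0 _] := hp.
apply: (@le_integrable _ _ _ mu _ measurableT _ (fun x => c%:E * (p x)%:E)%E).
- exact/measurable_EFinP/measurable_funM.
- move=> x _ /=; rewrite lee_fin !normrM mulrC ler_wpM2r//.
  by rewrite (le_trans (fc x))// ler_norm.
- exact: (integrableZl measurableT _ (density_integrable hp)).
Qed.

Lemma density_integral_le (R : realType) (d : measure_display)
    (T : measurableType d) (mu : {measure set T -> \bar R}) (p f g : T -> R) :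
    density mu p -> bounded_measurable f -> bounded_measurable g ->
    (forall x, f x <= g x) ->
  \int[mu]_x (p x * f x) <= \int[mu]_x (p x * g x).
Proof.
move=> hp bf bg fg; have [_ p0 _] := hp.
by apply: le_Rintegral => // [||x _]; [exact: density_integrableM..|rewrite ler_wpM2l].
Qed.

Lemma density_integral_lin (R : realType) (d : measure_display)
    (T : measurableType d) (mu : {measure set T -> \bar R}) (p f g : T -> R)
    (a b c : R) :
    density mu p -> bounded_measurable f -> bounded_measurable g ->
  \int[mu]_x (p x * (a * f x + b * g x + c)) =
  a * \int[mu]_x (p x * f x) + b * \int[mu]_x (p x * g x) + c.
Proof.
move=> hp bf bg; have [_ _ p1] := hp.
have If := density_integrableM hp bf; have Ig := density_integrableM hp bg.
have Ip := density_integrable hp.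
have E x : p x * (a * f x + b * g x + c) =
  a * (p x * f x) + b * (p x * g x) + c * p x by ring.
under eq_Rintegral do rewrite E.
have Iaf := integrableZl measurableT a If; have Ibg := integrableZl measurableT b Ig.
have Icp := integrableZl measurableT c Ip.
rewrite RintegralD//; last exact: (integrableD measurableT Iaf Ibg).
rewrite RintegralD// !RintegralZl//.
by rewrite /Rintegral p1 mulr1.
Qed.

Lemma bounded_measurable_lin (R : realType) (d : measure_display)
    (T : measurableType d) (f g : T -> R) (a b c : R) :
    bounded_measurable f -> bounded_measurable g ->
  bounded_measurable (fun x => a * f x + b * g x + c).
Proof.
move=> [mf [cf fcf]] [mg [cg gcg]]; split.
  by apply: measurable_funD => //; apply: measurable_funD; apply: measurable_funM.
exists (`|a| * cf + `|b| * cg + `|c|) => x.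
apply: (le_trans (ler_normD _ _)); rewrite lerD2r.
by apply: (le_trans (ler_normD _ _)); rewrite !normrM lerD// ler_wpM2l.
Qed.

Lemma bounded_measurableZ (R : realType) (d : measure_display)
    (T : measurableType d) (f : T -> R) (k : R) :
  bounded_measurable f -> bounded_measurable (fun x => k * f x).
Proof.
move=> [mf [c fc]]; split; first exact: measurable_funM.
by exists (`|k| * c) => x; rewrite normrM ler_wpM2l.
Qed.

Lemma bounded_measurable_expR (R : realType) (d : measure_display)
    (T : measurableType d) (f : T -> R) :
  bounded_measurable f -> bounded_measurable (fun x => expR (f x)).
Proof.
move=> [mf [c fc]]; split; first exact: measurableT_comp.
exists (expR c) => x; rewrite ger0_norm ?expR_ge0// ler_expR.
by rewrite (le_trans _ (fc x))// ler_norm.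
Qed.

(** * Tail of a product over an i.i.d. sample *)

(** Markov's inequality over a finite alphabet: by independence a word t has probability prod q (t
    i), which is at most prod s (t i) q (t i) / b when prod s (t i) >= b. Summed over all words,
    these products factor into an n-th power. *)
Lemma independent_prod_tail (R : realType) (n m : nat) (b : R)
    (d d' : measure_display) (T : measurableType d) (Omega : measurableType d')
    (P : probability Omega R) (X : 'I_n -> {RV P >-> T}) (A : set Omega)
    (C : 'I_m -> set T) (s q : 'I_m -> R) :
    0 < b -> mutually_independent X -> measurable A ->
    (forall k, measurable (C k)) -> (forall k, 0 <= s k) -> (forall k, 0 <= q k) ->
    (forall i k, distribution P (X i) (C k) = (q k)%:E) ->
    (forall w, A w -> exists2 t : {ffun 'I_n -> 'I_m},
       b <= \prod_i s (t i) & forall i, C (t i) (X i w)) ->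
  (P A <= ((\sum_k s k * q k) ^+ n / b)%:E)%E.
Proof.
move=> b0 indX mA mC s0 q0 XC HA.
pose E (t : {ffun 'I_n -> 'I_m}) : set Omega :=
  \bigcap_(i in [set` [set: 'I_n]%SET]) (X i @^-1` C (t i)).
have PE t : P (E t) = (\prod_i q (t i))%:E.
  rewrite /E (indX [set: 'I_n]%SET (fun i => C (t i))); last by move=> i _; exact: mC.
  rewrite -prodEFin; apply: eq_big => [i|i _]; first by rewrite !inE.
  by rewrite -(XC i).
have mE t : measurable (E t).
  apply: fin_bigcap_measurable => // i _.
  by rewrite -[_ @^-1` _]setTI; exact: (measurable_funPT (X i)).
apply: (@le_trans _ _ (\sum_(t : {ffun 'I_n -> 'I_m} | (b <= \prod_i s (t i))%R) P (E t))%E).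
  by apply: measure_le_sum => // w /HA[t bt Ct]; exists t => // i _; exact: Ct.
under eq_bigr do rewrite PE.
rewrite sumEFin lee_fin.
have -> : (\sum_k s k * q k) ^+ n =
    \sum_(t : {ffun 'I_n -> 'I_m}) \prod_i (s (t i) * q (t i)).
  by rewrite -(bigA_distr_bigA (fun=> fun k => s k * q k)) prodr_const card_ord.
rewrite mulr_suml [leRHS](bigID (fun t : {ffun 'I_n -> 'I_m} => b <= \prod_i s (t i)))/=.
rewrite -[leLHS]addr0 lerD//; last first.
  apply: sumr_ge0 => t _; rewrite mulr_ge0 ?invr_ge0 ?(ltW b0)//.
  by apply: prodr_ge0 => i _; rewrite mulr_ge0.
apply: ler_sum => t bt; rewrite ler_pdivlMr// big_split/= mulrC ler_wpM2r//.
exact: prodr_ge0.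
Qed.

(* Rounding f up to the next multiple of 1/n reduces the expectation of the
   product to a finite sum of probabilities of independent events, and costs the
   term 1/n. *)
Lemma iid_prod_tail (R : realType) (n m : nat) (b : R)
    (d d' : measure_display) (T : measurableType d) (Omega : measurableType d')
    (mu : {measure set T -> \bar R}) (p f : T -> R)
    (P : probability Omega R) (X : 'I_n -> {RV P >-> T}) (A : set Omega) :
    (0 < n)%N -> 0 < b -> density mu p -> iid_with_density mu p X ->
    measurable_fun setT f -> (forall x, 0 <= f x <= m%:R) ->
    measurable A -> (forall w, A w -> b <= \prod_i f (X i w)) ->
  (P A <= ((\int[mu]_x (p x * f x) + n%:R^-1) ^+ n / b)%:E)%E.
Proof.
move=> n0 b0 [mp p0 p1] [indX lawX] mf fm mA HA.
have nR0 : 0 < n%:R :> R by rewrite ltr0n.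
(* Level sets of f of width 1/n; the last index k = n m accommodates the value f = m. *)
pose C (k : 'I_(n * m).+1) : set T :=
  (fun x => n%:R * f x) @^-1` `[k%:R, k.+1%:R[%classic.
have mC k : measurable (C k).
  rewrite -[C k]setTI; apply: measurable_funM => //.
pose s (k : 'I_(n * m).+1) : R := k.+1%:R / n%:R.
have hp : density mu p by [].
have bf : bounded_measurable f.
  by split=> //; exists m%:R => x; have /andP[f0 ?] := fm x; rewrite ger0_norm.
have ip := density_integrable hp.
have Cfin k : density_measure mu p (C k) \is a fin_num.
  apply: integrable_fin_num => //; exact: integrableS ip.
pose q k := fine (density_measure mu p (C k)).
have q0 k : 0 <= q k by apply: fine_ge0; apply: integral_ge0 => x _; rewrite lee_fin.
have fC x : exists k, C k x.
  have /andP[f0 fle] := fm x.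
  have nf0 : 0 <= n%:R * f x by rewrite mulr_ge0// ltW.
  have lek : (Num.truncn (n%:R * f x) < (n * m).+1)%N.
    rewrite ltnS -(ler_nat R); apply: (le_trans (y := n%:R * f x)).
      by rewrite truncn_le.
    by rewrite natrM ler_wpM2l// ltW.
  by exists (Ordinal lek); rewrite /C /= in_itv/= truncn_itv.
have fs k x : C k x -> f x <= s k <= f x + n%:R^-1.
  rewrite /C /= in_itv/= => /andP[kx xk].
  rewrite /s ler_pdivlMr// mulrC (ltW xk)/= ler_pdivrMr// mulrDl mulVf ?gt_eqF//.
  by rewrite -natr1 lerD2r mulrC.
have s0 k : 0 <= s k by rewrite divr_ge0.
(* The cells partition the space and [s k] exceeds f by at most 1/n on [C k], so the sum is the
   integral of p times a step function bounded by f + 1/n. *)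
have sq : \sum_k s k * q k <= \int[mu]_x (p x * f x) + n%:R^-1.
  have bf' := bounded_measurable_lin 1 0 n%:R^-1 bf bf.
  have ipf' := density_integrableM hp bf'.
  have -> : \int[mu]_x (p x * f x) + n%:R^-1 =
      \int[mu]_x (p x * (1 * f x + 0 * f x + n%:R^-1)).
    by rewrite density_integral_lin// mul1r mul0r addr0.
  have UC : \big[setU/set0]_(k <- index_enum 'I_(n * m).+1) C k = setT.
    apply/seteqP; split => // x _; have [k Ck] := fC x.
    by rewrite (bigD1 k)//=; left.
  rewrite -lee_fin /Rintegral fineK; last exact: integrable_fin_num.
  rewrite -UC ge0_integral_bigsetU//=; last first.
  - move=> x _; rewrite lee_fin mulr_ge0// mul1r mul0r addr0 addr_ge0 ?invr_ge0 ?(ltW nR0)//.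
    by have /andP[] := fm x.
  - rewrite UC; exact: measurable_int ipf'.
  - move=> i j _ _ [x [Ci Cj]].
    move: Ci Cj; rewrite /C /= !in_itv/= => /andP[i1 i2] /andP[j1 j2].
    have := le_lt_trans i1 j2; have := le_lt_trans j1 i2.
    rewrite !ltr_nat => ji ij.
    by apply/val_inj/eqP; rewrite eqn_leq -ltnS ij -ltnS ji.
  - exact: index_enum_uniq.
  rewrite -sumEFin; apply: lee_sum => k _.
  have ipC : mu.-integrable (C k) (EFin \o p) by exact: integrableS ip.
  rewrite EFinM /q fineK// -(integralZl (mC k) ipC).
  apply: ge0_le_integral => //.
  - by move=> x _; rewrite -EFinM lee_fin mulr_ge0.
  - by apply/measurable_funTS/measurable_EFinP/measurable_funM.
  - by apply/measurable_funTS/measurable_int; exact: ipf'.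
  - move=> x /fs/andP[? ?]; rewrite -EFinM lee_fin mulrC mul1r mul0r addr0.
    by rewrite ler_wpM2l.
apply: (@le_trans _ _ ((\sum_k s k * q k) ^+ n / b)%:E); last first.
  rewrite lee_fin ler_pM2r ?invr_gt0// lerXn2r// nnegrE.
    by apply: sumr_ge0 => k _; rewrite mulr_ge0.
  by apply: le_trans sq; apply: sumr_ge0 => k _; rewrite mulr_ge0.
apply: (@independent_prod_tail _ _ _ _ _ _ _ _ _ X A C) => //.
  by move=> i k; rewrite lawX// /q fineK.
move=> w /HA bw.
pose t := [ffun i => projT1 (cid (fC (X i w)))].
have Ct i : C (t i) (X i w) by rewrite ffunE; case: cid.
exists t => //; apply: (le_trans bw); apply: ler_prod => i _.
by have /andP[-> _] := fm (X i w); have /andP[] := fs _ _ (Ct i).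
Qed.

(** * Measurable selection of a maximiser *)

(** The index is picked from the finite set of all maximisers and is determined by that set, which
    makes the selection measurable. A maximiser always exists, so the default [i0] is never
    invoked. *)
Definition argmax (R : realType) (S : Type) (I : finType) (i0 : I)
    (F : I -> S -> R) (s : S) : I :=
  odflt i0 [pick i in [set i | [forall j, F j s <= F i s]]%SET].

Lemma argmax_ge (R : realType) (S : Type) (I : finType) (i0 : I)
    (F : I -> S -> R) (s : S) (j : I) : F j s <= F (argmax i0 F s) s.
Proof.
rewrite /argmax; case: pickP => [i|/= nomax].
  by rewrite inE => /forallP/(_ j).
have [i _ imax] := @arg_maxP _ _ _ i0 xpredT (F ^~ s) isT.
by have := nomax i; rewrite inE => /negP[]; apply/forallP => k; exact: imax.
Qed.

(** The space is cut into the finitely many events [E A] on which the set of maximisers is exactly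
    A; each is a finite intersection of events [D i] and their complements. *)
Lemma measurable_argmax (R : realType) (d : measure_display)
    (S : measurableType d) (I : finType) (i0 : I) (F : I -> S -> R) (Q : set I) :
    (forall i, measurable_fun setT (F i)) ->
  measurable [set s | Q (argmax i0 F s)].
Proof.
move=> mF.
pose D i := \bigcap_(j in [set: I]) [set s | F j s <= F i s].
have mD i : measurable (D i).
  apply: fin_bigcap_measurable => // j _.
  by rewrite -[X in measurable X]setTI; exact: measurable_fun_le.
pose E (A : {set I}) := \bigcap_(i in [set: I]) (if i \in A then D i else ~` D i).
rewrite (_ : [set _ | _] =
  \bigcup_(A in [set A : {set I} | Q (odflt i0 [pick i in A])]) E A).
  apply: fin_bigcup_measurable => // A _; apply: fin_bigcap_measurable => // i _.
  by case: ifP => _ //; exact: measurableC.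
pose B s := [set i | [forall j, F j s <= F i s]]%SET.
have DB s i : D i s <-> i \in B s.
  rewrite /B inE; split=> [Dis|/forallP H j _]; last exact: H.
  by apply/forallP => j; exact: Dis.
apply/seteqP; split=> s.
  move=> Qs; exists (B s) => // i _; case: ifP => [/DB//|/negP iB] /DB; exact: iB.
move=> [A QA EA]; rewrite /argmax/= (_ : [set i | _]%SET = A)//.
apply/setP => i; have := EA i Logic.I; rewrite -/(B s).
case: ifP => iA; first by move/DB ->.
by move=> nDi; apply/negbTE/negP => /DB.
Qed.

(** Joint measurability holds because only finitely many densities can be selected: the estimator is
    a finite sum of indicators of selection events in s times functions of x. *)
Lemma density_estimator_argmax (R : realType) (d : measure_display)
    (T : measurableType d) (mu : {measure set T -> \bar R}) (n : nat)
    (I : finType) (i0 : I) (f : I -> T -> R) (F : I -> n.-tuple T -> R) :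
    (forall i, density mu (f i)) -> (forall i, measurable_fun setT (F i)) ->
  density_estimator mu (fun s => f (argmax i0 F s)).
Proof.
move=> df mF; split=> //.
rewrite (_ : (fun _ => _) = (fun z : n.-tuple T * T =>
    \sum_i \1_[set s | argmax i0 F s = i] z.1 * f i z.2)); last first.
  apply/funext => z; rewrite (bigD1 (argmax i0 F z.1))//= indicE mem_set// mul1r.
  rewrite big1 ?addr0// => i /eqP iN; rewrite indicE memNset ?mul0r// => /= E.
  by apply: iN.
apply: measurable_sum => i; apply: measurable_funM.
  by apply: measurableT_comp => //; apply: measurable_indic;
    exact: (measurable_argmax i0 [set i] mF).
by apply: measurableT_comp => //; have [] := df i.
Qed.

(** * Kullback-Leibler divergence *)

(** Positive and negative parts are compared separately, so f itself may fail to be integrable. This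
    serves divergences not yet known to be finite. *)
Lemma le_integral_integrabler (R : realType) (d : measure_display)
    (T : measurableType d) (mu : {measure set T -> \bar R}) (f g : T -> R) :
    measurable_fun setT f -> mu.-integrable setT (EFin \o g) ->
    (forall x, f x <= g x) ->
  (\int[mu]_x (f x)%:E <= \int[mu]_x (g x)%:E)%E.
Proof.
move=> mf ig fg; have /integrableP[mg _] := ig.
have mf' : measurable_fun setT (EFin \o f) by exact/measurable_EFinP.
rewrite integralE [leRHS]integralE leeB//.
  apply: ge0_le_integral => //; first exact: measurable_funepos.
    exact: measurable_funepos.
  by move=> x _; apply: (@funepos_le _ _ setT) => // [y _|]; rewrite ?lee_fin ?inE.
apply: ge0_le_integral => //; first exact: measurable_funeneg.
  exact: measurable_funeneg.
by move=> x _; apply: (@funeneg_le _ _ setT) => // [y _|]; rewrite ?lee_fin ?inE.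
Qed.

(** The negative part is dominated by g and has finite integral, so an integral below +oo leaves no
    room for an infinite positive part. *)
Lemma integrable_lty_neg_le (R : realType) (d : measure_display)
    (T : measurableType d) (mu : {measure set T -> \bar R}) (f g : T -> R) :
    measurable_fun setT f -> mu.-integrable setT (EFin \o g) ->
    (forall x, 0 <= g x) -> (forall x, - f x <= g x) ->
    (\int[mu]_x (f x)%:E < +oo)%E ->
  mu.-integrable setT (EFin \o f).
Proof.
move=> mf ig g0 fg foo; have mf' : measurable_fun setT (EFin \o f) by exact/measurable_EFinP.
have negoo : (\int[mu]_x ((EFin \o f)^\- x) < +oo)%E.
  apply: le_lt_trans (integrable_lty measurableT ig).
  apply: ge0_le_integral => //; first exact: measurable_funeneg.
    by have /integrableP[] := ig.
  by move=> x _; rewrite funenegE /= ge_max lee_fin fg lee_fin g0.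
have posoo : (\int[mu]_x ((EFin \o f)^\+ x) < +oo)%E.
  move: foo; rewrite integralE.
  have : (0 <= \int[mu]_x ((EFin \o f)^\- x))%E by exact: integral_ge0.
  have : (0 <= \int[mu]_x ((EFin \o f)^\+ x))%E by exact: integral_ge0.
  move: negoo; case: (\int[mu]_x ((EFin \o f)^\- x))%E => // a _.
  by case: (\int[mu]_x ((EFin \o f)^\+ x))%E => [b _ _ _||]//; rewrite ltry.
apply/integrableP; split => //.
rewrite -[X in integral _ _ X]/(abse \o (EFin \o f)) fune_abse.
rewrite ge0_integralD//; first exact: lte_add_pinfty.
  exact: measurable_funepos.
exact: measurable_funeneg.
Qed.

Lemma density_measure_le_dominates (R : realType) (d : measure_display)
    (T : measurableType d) (mu : {measure set T -> \bar R}) (q q' : T -> R)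
    (c : R) :
    density mu q -> density mu q' -> (forall x, q x <= c * q' x) ->
  density_measure mu q `<< density_measure mu q'.
Proof.
move=> dq dq' qq' N N0 A mA AN; have [mq q0 _] := dq; have [mq' q'0 _] := dq'.
apply/eqP; rewrite eq_le; apply/andP; split; last first.
  by apply: integral_ge0 => x _; rewrite lee_fin.
have iq' : mu.-integrable A (EFin \o q').
  by apply: integrableS (density_integrable dq').
apply: (@le_trans _ _ (\int[mu]_(x in A) (c%:E * (q' x)%:E))%E).
  apply: ge0_le_integral => //; first by move=> x _; rewrite lee_fin.
  - exact/measurable_funTS/measurable_EFinP.
  - by apply/measurable_funTS/measurable_EFinP/measurable_funM.
  - by move=> x _; rewrite -EFinM lee_fin.
by rewrite (integralZl mA iq') -/(density_measure mu q' A) N0// mule0.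
Qed.

(** Separates the two logarithms, for measurability and for cancellation. At b = 0 the conventions a
    / 0 = 0 and ln 0 = 0 annihilate the left side, hence the case split. *)
Lemma relative_entropyE (R : realType) (a b : R) : 0 <= a -> 0 <= b ->
  a * ln (a / b) = if b <= 0 then 0 else a * (ln a - ln b).
Proof.
move=> a0 b0; case: ifPn => [bN|]; last rewrite -ltNge => b0'.
  have -> : b = 0 by apply/eqP; rewrite eq_le bN.
  by rewrite invr0 mulr0 ln0 ?mulr0.
have [->|aN0] := eqVneq a 0; first by rewrite !mul0r.
by rewrite ln_div// posrE lt_neqAle eq_sym aN0.
Qed.

(** By [ln_ge1BV] at a / b, a ln (a / b) >= a - b. This controls the negative part of the divergence
    by the integrable function q. *)
Lemma relative_entropy_ge (R : realType) (a b : R) : 0 <= a -> 0 <= b ->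
  - (a * ln (a / b)) <= b.
Proof.
move=> a0 b0; have [->|aN0] := eqVneq a 0; first by rewrite mul0r oppr0.
have [->|bN0] := eqVneq b 0; first by rewrite invr0 mulr0 ln0// mulr0 oppr0.
have a1 : 0 < a by rewrite lt_neqAle eq_sym aN0.
have b1 : 0 < b by rewrite lt_neqAle eq_sym bN0.
have := ler_wpM2l a0 (ln_ge1BV (divr_gt0 a1 b1)).
rewrite invf_div mulrBr mulr1 mulrCA mulfV// mulr1; lra.
Qed.

Lemma measurable_KL (R : realType) (d : measure_display)
    (T : measurableType d) (mu : {measure set T -> \bar R}) (p q : T -> R) :
    density mu p -> density mu q ->
  measurable_fun setT (fun x => p x * ln (p x / q x)).
Proof.
move=> [mp p0 _] [mq q0 _].
under eq_fun do rewrite relative_entropyE//.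
apply: measurable_fun_ifT => //; first exact: measurable_fun_ler.
by apply: measurable_funM => //; apply: measurable_funB; apply: measurableT_comp.
Qed.

Lemma KL_integrable (R : realType) (d : measure_display)
    (T : measurableType d) (mu : {measure set T -> \bar R}) (p q : T -> R) :
    density mu p -> density mu q -> (KL mu p q < +oo)%E ->
  [/\ density_measure mu p `<< density_measure mu q,
      mu.-integrable setT (EFin \o (fun x => p x * ln (p x / q x))) &
      KL mu p q = (\int[mu]_x (p x * ln (p x / q x))%:E)%E].
Proof.
move=> dp dq; rewrite /KL; case: asboolP => // pq foo; split=> //.
have [_ p0 _] := dp; have [_ q0 _] := dq.
apply: (integrable_lty_neg_le (measurable_KL dp dq) (density_integrable dq)) => //.
by move=> x; exact: relative_entropy_ge.
Qed.

(** Chain rule ln (p / q') = ln (p / q) + ln (q / q'). The two-sided comparison makes q and q'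
    vanish together, so the identity survives the default values of the logarithm. *)
Lemma KL_bounded_ratio (R : realType) (d : measure_display)
    (T : measurableType d) (mu : {measure set T -> \bar R}) (p q q' : T -> R)
    (c c' : R) :
    density mu p -> density mu q -> density mu q' ->
    bounded_measurable (fun x => ln (q x) - ln (q' x)) ->
    (forall x, q x <= c * q' x) -> (forall x, q' x <= c' * q x) ->
    (KL mu p q < +oo)%E ->
  KL mu p q' = (KL mu p q + (\int[mu]_x (p x * (ln (q x) - ln (q' x))))%:E)%E.
Proof.
move=> dp dq dq' bZ qq' q'q KLoo.
have [pq ipq ->] := KL_integrable dp dq KLoo.
have [_ p0 _] := dp; have [_ q0 _] := dq; have [_ q'0 _] := dq'.
rewrite /KL asboolT; last first.
  exact: null_dominates_trans pq (density_measure_le_dominates dq dq' qq').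
have iZ := density_integrableM dp bZ.
rewrite /Rintegral fineK; last exact: integrable_fin_num.
rewrite -integralD//; apply: eq_integral => x _ /=; rewrite -EFinD; congr EFin.
rewrite !relative_entropyE//; case: ifPn => [q'x|].
  have q'x0 : q' x = 0 by apply/eqP; rewrite eq_le q'x q'0.
  have qx : q x <= 0 by have := qq' x; rewrite q'x0 mulr0.
  by rewrite qx !ln0// subrr mulr0 addr0.
rewrite -ltNge => q'x; case: ifPn => [qx|_]; last by rewrite -mulrDr; congr (_ * _); ring.
have qx0 : q x = 0 by apply/eqP; rewrite eq_le qx q0.
by have := q'q x; rewrite qx0 mulr0 leNgt q'x.
Qed.

(* On {q = 0} the integrand of KL mu p q is 0, whatever p; but p vanishes almost
   everywhere there, by absolute continuity. *)
Lemma KL_le_smoothing (R : realType) (d : measure_display)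
    (T : measurableType d) (mu : {measure set T -> \bar R}) (p q q' : T -> R)
    (c : R) :
    density mu p -> density mu q -> density mu q' -> 1 <= c ->
    (forall x, q x <= c * q' x) ->
  (KL mu p q' <= KL mu p q + (ln c)%:E)%E.
Proof.
move=> dp dq dq' c1 qq'.
have [|] := leP +oo%E (KL mu p q); first by rewrite leye_eq => /eqP ->; rewrite leey.
move=> KLoo; have [pq ipq ->] := KL_integrable dp dq KLoo.
have [mp p0 p1] := dp; have [mq q0 _] := dq; have [_ q'0 _] := dq'.
have c0 : 0 < c by exact: lt_le_trans c1.
rewrite /KL asboolT; last first.
  exact: null_dominates_trans pq (density_measure_le_dominates dq dq' qq').
pose N := [set x | q x <= 0].
have mN : measurable N.
  by rewrite -[N]setTI; apply: measurable_fun_le.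
have qN x : N x -> q x = 0 by move=> Nx; apply/eqP; rewrite eq_le Nx q0.
have pN : ae_eq mu N (EFin \o p) (cst 0%E).
  apply/ae_eq_integral_abs => //; first exact/measurable_funTS/measurable_EFinP.
  under eq_integral do rewrite /= ger0_norm//.
  apply: (pq N) => // A mA AN; rewrite /density_measure.
  rewrite -[RHS](integral0 mu A); apply: eq_integral => x /set_mem /AN /qN ->//.
(* [g] equals the integrand for q' almost everywhere, and is pointwise below the integrand for q
   plus ln c times p; the unmodified integrand may exceed that bound on {q = 0}. *)
pose g x := if q x <= 0 then 0 else p x * ln (p x / q' x).
have mg : measurable_fun setT g.
  apply: measurable_fun_ifT => //; first exact: measurable_fun_ler.
  exact: (measurable_KL dp dq').
rewrite (ae_eq_integral (EFin \o g)) //; last first.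
- apply: filterS pN => x pNx _ /=; rewrite /g; case: ifPn => // qx.
  by case: (pNx qx) => ->; rewrite mul0r.
- exact/measurable_EFinP.
- exact/measurable_EFinP/(measurable_KL dp dq').
have icp := integrableZl measurableT (ln c) (density_integrable dp).
have ipq' : mu.-integrable setT
    (EFin \o (fun x => p x * ln (p x / q x) + ln c * p x)).
  exact: (integrableD measurableT ipq icp).
apply: (le_trans (le_integral_integrabler mg ipq' _)).
  move=> x; rewrite /g.
  case: ifPn => [qx|]; last rewrite -ltNge => qx.
    by rewrite qN// invr0 mulr0 ln0// mulr0 add0r mulr_ge0// ln_ge0.
  have q'x : 0 < q' x by have := qq' x; rewrite -(pmulr_rgt0 _ c0); lra.
  rewrite !relative_entropyE// (lt_geF qx) (lt_geF q'x) [ln c * _]mulrC -mulrDr ler_wpM2l//.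
  have : ln (q x) <= ln (c * q' x) by rewrite ler_ln ?posrE// mulr_gt0.
  by rewrite lnM ?posrE//; lra.
rewrite le_eqVlt; apply/orP; left; apply/eqP.
transitivity (\int[mu]_x (p x * ln (p x / q x))%:E +
              \int[mu]_x ((ln c)%:E * (p x)%:E))%E.
  exact: (integralD measurableT ipq icp).
by rewrite (integralZl measurableT (density_integrable dp)) p1 mule1.
Qed.

(** * Mixtures and the excess risk *)

Definition mix (R : realType) (T : Type) (M : nat) (p : 'I_M -> T -> R)
  (theta : 'I_M -> R) (x : T) : R := \sum_(j < M) theta j * p j x.

(** The value c = 0 gives all mixture weights; c = 1 / K gives the truncated simplex, on which
    log-likelihood ratios are bounded by ln K. *)
Definition simplex (R : realType) (M : nat) (c : R) (theta : 'I_M -> R) : Prop :=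
  (forall j, c <= theta j) /\ \sum_(j < M) theta j = 1.

Lemma simplex_le1 (R : realType) (M : nat) (c : R) (theta : 'I_M -> R) (j : 'I_M) :
  0 <= c -> simplex c theta -> theta j <= 1.
Proof.
move=> c0 [tc <-]; rewrite (bigD1 j)//= lerDl; apply: sumr_ge0 => i _.
exact: le_trans (tc i).
Qed.

Lemma simplex_weaken (R : realType) (M : nat) (c : R) (theta : 'I_M -> R) :
  0 <= c -> simplex c theta -> simplex 0 theta.
Proof. by move=> c0 [tc t1]; split=> // j; exact: le_trans (tc j). Qed.

Lemma simplex_conv (R : realType) (M : nat) (c l : R) (theta theta' : 'I_M -> R) :
    0 <= l <= 1 -> simplex c theta -> simplex c theta' ->
  simplex c (fun j => (1 - l) * theta j + l * theta' j).
Proof.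
move=> /andP[l0 l1] [tc t1] [tc' t1']; split=> [j|].
  by have := tc j; have := tc' j; nra.
by rewrite big_split/= -!mulr_sumr t1 t1' !mulr1 subrK.
Qed.

Lemma mix_le (R : realType) (T : Type) (M : nat) (p : 'I_M -> T -> R)
    (c : R) (theta theta' : 'I_M -> R) (x : T) :
    (forall j, 0 <= p j x) -> (forall j, theta j <= c * theta' j) ->
  mix p theta x <= c * mix p theta' x.
Proof.
move=> p0 tt'; rewrite /mix mulr_sumr; apply: ler_sum => j _.
by rewrite mulrA ler_wpM2r.
Qed.

(** A weight is at most 1, whereas K times a weight of [theta'] is at least 1. *)
Lemma simplex_ratio (R : realType) (M : nat) (K : R) (theta theta' : 'I_M -> R)
    (j : 'I_M) : 0 < K -> simplex K^-1 theta -> simplex K^-1 theta' ->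
  theta j <= K * theta' j.
Proof.
move=> K0 st [tc' _]; have K0' : 0 <= K^-1 by rewrite invr_ge0 ltW.
apply: (le_trans (simplex_le1 j K0' st)).
by rewrite -(ler_pM2l (_ : 0 < K^-1)) ?invr_gt0// mulr1 mulKf ?gt_eqF.
Qed.

Lemma mix_density (R : realType) (d : measure_display) (T : measurableType d)
    (mu : {measure set T -> \bar R}) (M : nat) (p : 'I_M -> T -> R)
    (theta : 'I_M -> R) :
  (forall j, density mu (p j)) -> simplex 0 theta -> density mu (mix p theta).
Proof.
move=> hp [t0 t1]; split.
- by apply: measurable_sum => j; apply: measurable_funM => //; have [] := hp j.
- move=> x; apply: sumr_ge0 => j _; have [_ p0 _] := hp j.
  by rewrite mulr_ge0.
under eq_integral do rewrite -sumEFin.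
rewrite ge0_integral_sum//.
- transitivity (\sum_(j < M) (theta j)%:E)%E; last by rewrite sumEFin t1.
  apply: eq_bigr => j _; under eq_integral do rewrite EFinM.
  rewrite (integralZl measurableT (density_integrable (hp j))).
  by have [_ _ ->] := hp j; rewrite mule1.
- move=> j; apply/measurable_EFinP; apply: measurable_funM => //.
  by have [] := hp j.
- by move=> j x _; have [_ p0 _] := hp j; rewrite lee_fin mulr_ge0.
Qed.

(* Equal to 0 where all the p j vanish, for positive weights. *)
Definition log_ratio (R : realType) (T : Type) (M : nat) (p : 'I_M -> T -> R)
  (theta theta' : 'I_M -> R) (x : T) : R :=
  ln (mix p theta x) - ln (mix p theta' x).

(** The lower bounds 1 / K supply the reverse comparison that [ln_ratio_le] requires, while c may be
    far smaller than K, such as 1 + 1/n. *)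
Lemma log_ratio_le (R : realType) (T : Type) (M : nat) (p : 'I_M -> T -> R)
    (c K : R) (theta theta' : 'I_M -> R) (x : T) :
    (forall j, 0 <= p j x) -> 1 <= c -> 0 < K ->
    simplex K^-1 theta -> simplex K^-1 theta' ->
    (forall j, theta j <= c * theta' j) ->
  log_ratio p theta theta' x <= ln c.
Proof.
move=> p0 c1 K0 st st' tc; apply: (@ln_ratio_le _ _ _ c K) => //.
- apply: sumr_ge0 => j _; rewrite mulr_ge0//; have [tK _] := st.
  by rewrite (le_trans _ (tK j))// invr_ge0 ltW.
- exact: mix_le.
- by apply: mix_le => // j; exact: simplex_ratio.
Qed.

Lemma bounded_log_ratio (R : realType) (d : measure_display)
    (T : measurableType d) (mu : {measure set T -> \bar R}) (M : nat)
    (p : 'I_M -> T -> R) (K : R) (theta theta' : 'I_M -> R) :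
    (forall j, density mu (p j)) -> 1 <= K ->
    simplex K^-1 theta -> simplex K^-1 theta' ->
  bounded_measurable (log_ratio p theta theta').
Proof.
move=> hp K1 st st'; have K0 : 0 < K by exact: lt_le_trans K1.
have K0' : 0 <= K^-1 by rewrite invr_ge0 ltW.
have [mt _ _] := mix_density hp (simplex_weaken K0' st).
have [mt' _ _] := mix_density hp (simplex_weaken K0' st').
split; first by apply: measurable_funB; exact: measurableT_comp.
have p0 x j : 0 <= p j x by have [_ + _] := hp j.
exists (ln K) => x; rewrite ler_norml lerNl; apply/andP; split.
  rewrite opprB -/(log_ratio p theta' theta x) (@log_ratio_le _ _ _ _ _ K)// => j.
  exact: simplex_ratio.
by rewrite (@log_ratio_le _ _ _ _ _ K)// => j; exact: simplex_ratio.
Qed.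

Lemma mix_conv (R : realType) (T : Type) (M : nat) (p : 'I_M -> T -> R)
    (l : R) (theta theta' : 'I_M -> R) (x : T) :
  mix p (fun j => (1 - l) * theta j + l * theta' j) x =
  (1 - l) * mix p theta x + l * mix p theta' x.
Proof.
rewrite /mix !mulr_sumr -big_split/=; apply: eq_bigr => j _; ring.
Qed.

(** Let [eta] move a fraction l of the way from [theta] to [theta']. By [ln_mix_ge] its log-ratio to
    [theta] is at least l (W - 1) - 2 l^2 (W - 1)^2, where 0 <= W <= K and so (W - 1)^2 <= K^2. Its
    expectation is at most e by near-optimality; dividing by l gives the bound. *)
Lemma near_optimal_likelihood_ratio (R : realType) (d : measure_display)
    (T : measurableType d) (mu : {measure set T -> \bar R}) (M : nat)
    (p : 'I_M -> T -> R) (pstar : T -> R) (K l e : R)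
    (theta theta' : 'I_M -> R) :
    density mu pstar -> (forall j, density mu (p j)) -> 1 <= K ->
    0 < l <= 2^-1 -> simplex K^-1 theta -> simplex K^-1 theta' ->
    (forall eta, simplex K^-1 eta ->
       \int[mu]_x (pstar x * log_ratio p eta theta x) <= e) ->
  \int[mu]_x (pstar x * expR (log_ratio p theta' theta x)) <=
  1 + e / l + 2 * l * K ^+ 2.
Proof.
move=> hps hp K1 /andP[l0 l2] st st' opt.
have K0 : 0 < K by exact: lt_le_trans K1.
have K0' : 0 <= K^-1 by rewrite invr_ge0 ltW.
have p0 x j : 0 <= p j x by have [_ + _] := hp j.
have l01 : 0 <= l <= 1 by rewrite (ltW l0) (le_trans l2)// invf_le1// ler1n.
have seta := simplex_conv l01 st st'.
set eta := fun j => _ in seta.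
have bW := bounded_measurable_expR (bounded_log_ratio hp K1 st' st).
set W := fun x => expR _ in bW.
have WK x : 0 <= W x <= K.
  rewrite expR_ge0/= -[leRHS]lnK ?posrE// ler_expR.
  by apply: (@log_ratio_le _ _ _ _ _ K) => // j; exact: simplex_ratio.
have := density_integral_le hps
  (bounded_measurable_lin l 0 (- l - 2 * l ^+ 2 * K ^+ 2) bW bW)
  (bounded_log_ratio hp K1 seta st).
rewrite density_integral_lin// mul0r addr0 => H.
have {H} := le_trans (H _) (opt _ seta).
set EW := \int[mu]_x (pstar x * W x) => H.
have {H} H : l * EW <= e + l + 2 * l ^+ 2 * K ^+ 2.
  suff : l * EW + (- l - 2 * l ^+ 2 * K ^+ 2) <= e by lra.
  apply: H => x.
  have := @ln_mix_ge _ (mix p theta x) (mix p theta' x) K l.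
  have mix0 t : simplex K^-1 t -> 0 <= mix p t x.
    move=> [tc _]; apply: sumr_ge0 => j _; rewrite mulr_ge0//.
    exact: le_trans (tc j).
  move=> /(_ (mix0 _ st) (mix0 _ st')).
  rewrite !mix_le// => [|j|j]; [|exact: simplex_ratio..].
  move=> /(_ isT isT); rewrite (ltW l0) l2 => /(_ isT).
  rewrite -mix_conv -/(log_ratio p theta' theta x) -/(log_ratio p eta theta x).
  rewrite -/(W x) => lb; apply: le_trans lb; rewrite mul0r addr0.
  have /andP[W0 W1] := WK x.
  have : (W x - 1) ^+ 2 <= K ^+ 2 by nra.
  rewrite exprMn; have := sqr_ge0 l; nra.
rewrite -(ler_pM2l l0) (le_trans H)// le_eqVlt; apply/orP; left; apply/eqP.
by field; rewrite gt_eqF.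
Qed.

(** Integrate [excess_pointwise] at z = [log_ratio p theta' theta x], after expanding its right side
    as - 2 a v + (a - 1) v^2 + a + 1 with v = exp (z / 2). *)
Lemma excess_risk_le (R : realType) (d : measure_display)
    (T : measurableType d) (mu : {measure set T -> \bar R}) (M : nat)
    (p : 'I_M -> T -> R) (pstar : T -> R) (K a k : R)
    (theta theta' : 'I_M -> R) :
    density mu pstar -> (forall j, density mu (p j)) -> 1 <= K ->
    simplex K^-1 theta -> simplex K^-1 theta' -> 5 <= a -> 4 * ln K <= a ->
    \int[mu]_x (pstar x * expR (log_ratio p theta' theta x)) <= 1 + k ->
  - (\int[mu]_x (pstar x * log_ratio p theta' theta x)) <=
  2 * a * (1 - \int[mu]_x (pstar x * expR (2^-1 * log_ratio p theta' theta x)))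
  + (a - 1) * k.
Proof.
move=> hps hp K1 st st' a5 aK.
have K0 : 0 < K by exact: lt_le_trans K1.
have p0 x j : 0 <= p j x by have [_ + _] := hp j.
have bD := bounded_log_ratio hp K1 st' st.
have bW := bounded_measurable_expR bD.
have bV := bounded_measurable_expR (bounded_measurableZ 2^-1 bD).
have := density_integral_le hps (bounded_measurable_lin (-1) 0 0 bD bD)
  (bounded_measurable_lin (- 2 * a) (a - 1) (a + 1) bV bW).
rewrite !density_integral_lin// => H EWk.
move: H EWk; set EW := \int[mu]_x (pstar x * expR (log_ratio p theta' theta x)).
set ED := \int[mu]_x (pstar x * log_ratio p theta' theta x).
set EV := \int[mu]_x _ => H EWk.
have {H} : -1 * ED + 0 * ED + 0 <= -2 * a * EV + (a - 1) * EW + (a + 1).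
  apply: H => x; set D := log_ratio _ _ _ _.
  have DK : - D <= ln K.
    rewrite /D /log_ratio opprB -/(log_ratio p theta theta' x).
    by apply: (@log_ratio_le _ _ _ _ _ K) => // j; exact: simplex_ratio.
  have := @excess_pointwise _ a D a5.
  have -> : expR D = (expR (2^-1 * D)) ^+ 2.
    by rewrite -expRM_natl; congr expR; field.
  have -> : - (4 * D) <= a by lra.
  move=> /(_ isT); set v := expR _; rewrite !expr2; nra.
nra.
Qed.

(** * The net of weights *)

(** Weights proportional to integers between 1 and m + 1; starting at 1 rather than 0 is what bounds
    them below. *)
Definition net_weight (R : realType) (M m : nat) (k : {ffun 'I_M -> 'I_m.+1})
  (j : 'I_M) : R := (k j).+1%:R / \sum_(l < M) (k l).+1%:R.

Lemma net_weight_simplex (R : realType) (M m : nat)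
    (k : {ffun 'I_M -> 'I_m.+1}) : (0 < M)%N ->
  simplex (M * m.+1)%:R^-1 (@net_weight R M m k).
Proof.
move=> M0.
have S0 : 0 < \sum_(l < M) (k l).+1%:R :> R.
  rewrite (bigD1 (Ordinal M0))//= ltr_pwDl// ?ltr0n//.
  by apply: sumr_ge0 => l _; rewrite ler0n.
have SM : \sum_(l < M) (k l).+1%:R <= (M * m.+1)%:R :> R.
  rewrite natrM -[M in M%:R]card_ord mulr_natl -sumr_const; apply: ler_sum => l _.
  by rewrite ler_nat.
split=> [j|]; last by rewrite /net_weight -mulr_suml mulfV// gt_eqF.
rewrite /net_weight -[leLHS]mul1r ler_pM ?invr_ge0 ?ler0n ?ler1n//.
by rewrite lef_pV2 ?posrE// ltr0n muln_gt0 M0.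
Qed.

(** Take k j = floor (n M theta j). Then (k j) + 1 >= n M theta j, while the normalising sum is at
    most n M + M = (1 + 1/n) n M. *)
Lemma net_weight_approx (R : realType) (M n : nat) (theta : 'I_M -> R) :
    (0 < M)%N -> (0 < n)%N -> simplex 0 theta ->
  exists k : {ffun 'I_M -> 'I_(n * M).+1},
    forall j, theta j <= (1 + n%:R^-1) * net_weight R k j.
Proof.
move=> M0 n0 st; have [t0 t1] := st.
have tn j : 0 <= (n * M)%:R * theta j by rewrite mulr_ge0.
have kn j : (Num.truncn ((n * M)%:R * theta j) < (n * M).+1)%N.
  rewrite ltnS -(ler_nat R); apply: (le_trans (y := (n * M)%:R * theta j)).
    by rewrite truncn_le.
  by rewrite ler_piMr// (simplex_le1 j (lexx 0) st).
exists [ffun j => Ordinal (kn j)] => j; rewrite /net_weight.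
set S := \sum_(l < M) _.
have SE : S = \sum_(l < M) (Num.truncn ((n * M)%:R * theta l)).+1%:R.
  by apply: eq_bigr => l _; rewrite ffunE.
have S0 : 0 < S.
  rewrite SE (bigD1 (Ordinal M0))//= ltr_pwDl// ?ltr0n//.
  by apply: sumr_ge0 => l _; rewrite ler0n.
have SM : S <= (n%:R + 1) * M%:R.
  have -> : (n%:R + 1) * M%:R = \sum_(l < M) ((n * M)%:R * theta l + 1).
    by rewrite big_split/= -mulr_sumr t1 sumr_const card_ord natrM; ring.
  rewrite SE; apply: ler_sum => l _; rewrite -natr1 lerD2r truncn_le//.
rewrite ffunE mulrA ler_pdivlMr//=.
have n0' : 0 < n%:R :> R by rewrite ltr0n.
have nc : n%:R * (1 + n%:R^-1) = n%:R + 1 :> R.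
  by rewrite mulrDr mulr1 mulfV// gt_eqF.
have c0 : 0 < 1 + n%:R^-1 :> R by rewrite addr_gt0// invr_gt0.
have /andP[_ /ltW jn] := truncn_itv (tn j).
apply: (@le_trans _ _ ((1 + n%:R^-1) * ((n * M)%:R * theta j))).
  apply: (le_trans (ler_wpM2l (t0 j) SM)).
  by rewrite -nc natrM le_eqVlt; apply/orP; left; apply/eqP; ring.
by rewrite ler_pM2l.
Qed.

Lemma ln1D_inv_le (R : realType) (n : nat) : ln (1 + n%:R^-1) <= n%:R^-1 :> R.
Proof. by apply: le_ln1Dx; rewrite (@lt_le_trans _ _ 0)// invr_ge0. Qed.

Lemma integral_log_ratio_sub (R : realType) (d : measure_display)
    (T : measurableType d) (mu : {measure set T -> \bar R}) (M : nat)
    (p : 'I_M -> T -> R) (pstar : T -> R) (K : R) (t0 t1 t2 : 'I_M -> R) :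
    density mu pstar -> (forall j, density mu (p j)) -> 1 <= K ->
    simplex K^-1 t0 -> simplex K^-1 t1 -> simplex K^-1 t2 ->
  \int[mu]_x (pstar x * log_ratio p t1 t2 x) =
  \int[mu]_x (pstar x * log_ratio p t0 t2 x) -
  \int[mu]_x (pstar x * log_ratio p t0 t1 x).
Proof.
move=> hps hp K1 s0 s1 s2.
have := density_integral_lin 1 (-1) 0 hps (bounded_log_ratio hp K1 s0 s2)
  (bounded_log_ratio hp K1 s0 s1).
rewrite mul1r mulN1r addr0 => <-; apply: eq_Rintegral => x _.
by congr (_ * _); rewrite /log_ratio; ring.
Qed.

(** A minimiser over the truncated simplex need not be at hand, so [theta] is only within e of the
    infimum. The extra 1/n is the price of replacing an arbitrary mixture by one with weights at
    least 1 / K. *)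
Lemma near_optimal_weights (R : realType) (d : measure_display)
    (T : measurableType d) (mu : {measure set T -> \bar R}) (M n : nat)
    (p : 'I_M -> T -> R) (pstar q : T -> R) (e : R) :
    let K := (M * (n * M).+1)%:R in
    (0 < M)%N -> (0 < n)%N -> 0 < e -> density mu pstar ->
    (forall j, density mu (p j)) -> mixtures p q -> (KL mu pstar q < +oo)%E ->
  exists theta : 'I_M -> R, [/\ simplex K^-1 theta,
    forall eta, simplex K^-1 eta ->
      \int[mu]_x (pstar x * log_ratio p eta theta x) <= e &
    forall eta, simplex K^-1 eta ->
      (KL mu pstar (mix p eta) <= ereal_inf [set KL mu pstar q | q in mixtures p]
        + (\int[mu]_x (pstar x * log_ratio p theta eta x) + e + n%:R^-1)%:E)%E].
Proof.
move=> K M0 n0 e0 hps hp [zeta0 [z0 z1 ->]] KLoo.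
have K1 : 1 <= K by rewrite ler1n muln_gt0 M0.
have K0 : 0 < K by exact: lt_le_trans K1.
have K0' : 0 <= K^-1 by rewrite invr_ge0 ltW.
have p0 x j : 0 <= p j x by have [_ + _] := hp j.
have S0 t (st : simplex K^-1 t) := mix_density hp (simplex_weaken K0' st).
have n0' : 0 <= n%:R^-1 :> R by rewrite invr_ge0.
have smooth zeta : simplex 0 zeta -> exists2 t, simplex K^-1 t &
    (KL mu pstar (mix p t) <= KL mu pstar (mix p zeta) + (n%:R^-1)%:E)%E.
  move=> sz; have [k kz] := net_weight_approx M0 n0 sz.
  have sk := net_weight_simplex R k M0.
  exists (net_weight R k) => //.
  apply: (@le_trans _ _ (KL mu pstar (mix p zeta) + (ln (1 + n%:R^-1))%:E)%E);
    last by apply: leeD2l; rewrite lee_fin; exact: ln1D_inv_le.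
  apply: KL_le_smoothing => //; [exact: mix_density|exact: S0|by rewrite lerDl|].
  by move=> x; exact: mix_le.
have [t0 st0 KL0] := smooth zeta0 (conj z0 z1).
have {}KL0 : (KL mu pstar (mix p t0) < +oo)%E.
  by apply: (le_lt_trans KL0); rewrite lte_add_pinfty// ltry.
have := KL_integrable hps (S0 _ st0) KL0.
case=> _ /(integrable_fin_num measurableT) + KLE; rewrite -KLE => /fineK K0E.
set k0 := fine _ in K0E.
(* Risk relative to the reference [t0], of finite divergence: it turns comparisons of divergences
   into comparisons of real numbers. *)
pose r t := \int[mu]_x (pstar x * log_ratio p t0 t x).
have KLr t : simplex K^-1 t -> KL mu pstar (mix p t) = (k0 + r t)%:E.
  move=> st; rewrite (@KL_bounded_ratio _ _ _ mu pstar (mix p t0) _ K K)//.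
  - by rewrite -K0E -EFinD.
  - exact: S0.
  - exact: S0.
  - exact: bounded_log_ratio hp K1 st0 st.
  - by move=> x; apply: mix_le => // j; exact: simplex_ratio.
  - by move=> x; apply: mix_le => // j; exact: simplex_ratio.
pose E := [set r t | t in simplex K^-1].
have hE : has_inf E.
  split; first by exists (r t0), t0.
  (* Log-ratios on the truncated simplex are at least - ln K, hence so is r. *)
  exists (- ln K) => _ [t st <-].
  have := density_integral_lin 1 0 (ln K) hps (bounded_log_ratio hp K1 st0 st)
    (bounded_log_ratio hp K1 st0 st).
  rewrite mul0r addr0 -/(r t) => EK.
  suff : 0 <= \int[mu]_x (pstar x * (1 * log_ratio p t0 t x +
                           0 * log_ratio p t0 t x + ln K)) by rewrite EK; lra.
  apply: Rintegral_ge0 => x _; have [_ ps0 _] := hps; rewrite mulr_ge0//.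
  have := @log_ratio_le _ _ _ p K K t t0 x (p0 x) K1 K0 st st0
    (fun j => simplex_ratio j K0 st st0).
  by rewrite /log_ratio; lra.
have [_ [theta stheta <-] rtheta] := inf_adherent e0 hE.
have infr t : simplex K^-1 t -> r theta <= r t + e.
  move=> st; apply: (le_trans (ltW rtheta)); rewrite lerD2r.
  by apply: ge_inf; [have [_] := hE|exists t].
exists theta; split=> // eta seta.
  rewrite (integral_log_ratio_sub hps hp K1 st0 seta stheta) -/(r _) -/(r _).
  by rewrite lerBlDl infr.
rewrite (integral_log_ratio_sub hps hp K1 st0 stheta seta) -/(r _) -/(r _).
rewrite KLr// -leeBlDr// -EFinB; apply: le_ereal_inf_tmp => _ [_ [z [zz0 zz1 ->]] <-].
have [t st] := smooth z (conj zz0 zz1).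
rewrite KLr// -leeBlDr// -EFinB; apply: le_trans; rewrite lee_fin.
by have := infr t st; lra.
Qed.

(** * Probability of selecting a mixture *)

(** Here x stands for 1 - E exp (D / 2) and a = 8 L. The target 3/2 + M L + ld covers the loss in
    [chernoff_arith], the logarithm of the net size and ln (1 / delta). If it failed, multiplying by
    n would give 27 M L^2 + 6 L ld < 28 L + 3/2, impossible for M >= 2 and L >= 11/12. *)
Lemma bound_arith (R : realType) (M n : nat) (L ld x k : R) :
    (2 <= M)%N -> (0 < n)%N -> 11 / 12 <= L -> 0 <= ld ->
    (43 * M%:R * L ^+ 2 + 22 * L * ld) / n%:R - 2 * n%:R^-1 <=
      2 * (8 * L) * x + (8 * L - 1) * k ->
    k = (2 * n%:R)^-1 ->
  3 / 2 + M%:R * L + ld <= n%:R * x.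
Proof.
move=> M2 n0 L1 ld0 H kE.
have n0' : 0 < n%:R :> R by rewrite ltr0n.
have M2' : 2 <= M%:R :> R by rewrite ler_nat.
have {H} : n%:R * ((43 * M%:R * L ^+ 2 + 22 * L * ld) / n%:R - 2 * n%:R^-1) <=
    n%:R * (2 * (8 * L) * x + (8 * L - 1) * k) by rewrite ler_pM2l.
have -> : n%:R * ((43 * M%:R * L ^+ 2 + 22 * L * ld) / n%:R - 2 * n%:R^-1) =
    43 * M%:R * L ^+ 2 + 22 * L * ld - 2 by field; rewrite gt_eqF.
have -> : n%:R * (2 * (8 * L) * x + (8 * L - 1) * k) =
    16 * L * (n%:R * x) + (8 * L - 1) / 2 by rewrite kE; field; rewrite gt_eqF.
set y := n%:R * x => H; rewrite leNgt; apply/negP => yl.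
have L0 : 0 < L by lra.
have : 16 * L * y <= 16 * L * (3 / 2 + M%:R * L + ld).
  by rewrite ler_pM2l ?mulr_gt0// ltW.
have ML : 2 * L ^+ 2 <= M%:R * L ^+ 2 by rewrite ler_wpM2r// sqr_ge0.
have LL : 11 / 12 * L <= L ^+ 2 by rewrite expr2 ler_wpM2r// ltW.
have Lld : 0 <= L * ld by rewrite mulr_ge0// ltW.
have -> : 16 * L * (3 / 2 + M%:R * L + ld) =
  24 * L + 16 * (M%:R * L ^+ 2) + 16 * (L * ld) by field.
have E : 43 * M%:R * L ^+ 2 + 22 * L * ld =
  43 * (M%:R * L ^+ 2) + 22 * (L * ld) by ring.
lra.
Qed.

(** From u <= exp (u - 1) at u = v + 1/n. The 3/2 is 1 from the rounding term 1/n plus 1/2 from the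
    threshold exp (- 1/2). *)
Lemma chernoff_arith (R : realType) (n : nat) (v : R) :
    (0 < n)%N -> 0 <= v ->
  (v + n%:R^-1) ^+ n / expR (- 2^-1) <= expR (3 / 2 - n%:R * (1 - v)).
Proof.
move=> n0 v0; have n0' : 0 < n%:R :> R by rewrite ltr0n.
have nV : 0 < n%:R^-1 :> R by rewrite invr_gt0.
rewrite -expRN opprK.
have -> : 3 / 2 - n%:R * (1 - v) = n%:R * (v + n%:R^-1 - 1) + 2^-1.
  by field; rewrite gt_eqF.
rewrite expRD ler_pM2r ?expR_gt0// expRM_natl lerXn2r// ?nnegrE ?expR_ge0//.
  by rewrite addr_ge0// ltW.
by have := expR_ge1Dx (v + n%:R^-1 - 1); lra.
Qed.

(** Log-likelihood of the sample. A point where all the [p j] vanish adds the default ln 0 = 0 to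
    every score, so it does not affect the comparison. *)
Definition net_score (R : realType) (T : Type) (M m n : nat) (p : 'I_M -> T -> R)
    (k : {ffun 'I_M -> 'I_m.+1}) (s : n.-tuple T) : R :=
  \sum_(i < n) ln (mix p (net_weight R k) (tnth s i)).

Lemma net_selection_prob (R : realType) (M n : nat)
    (d d' : measure_display) (T : measurableType d) (Omega : measurableType d')
    (mu : {measure set T -> \bar R}) (p : 'I_M -> T -> R) (pstar : T -> R)
    (P : probability Omega R) (X : 'I_n -> {RV P >-> T})
    (theta : 'I_M -> R) (k0 k : {ffun 'I_M -> 'I_(n * M).+1}) (A : set Omega) :
    let K := (M * (n * M).+1)%:R in
    (0 < M)%N -> (0 < n)%N -> density mu pstar -> (forall j, density mu (p j)) ->
    iid_with_density mu pstar X -> simplex K^-1 theta -> measurable A ->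
    (forall w, A w -> argmax k0 (net_score p) [tuple X i w | i < n] = k) ->
  (P A <= (expR (3 / 2 - n%:R * (1 - \int[mu]_x
     (pstar x * expR (2^-1 * log_ratio p (net_weight R k) theta x)))))%:E)%E.
Proof.
move=> K M0 n0 hps hp iidX st mA HA.
have K1 : 1 <= K by rewrite ler1n muln_gt0 M0.
have K0 : 0 < K by exact: lt_le_trans K1.
have K0' : 0 <= K^-1 by rewrite invr_ge0 ltW.
have n0' : 0 < n%:R :> R by rewrite ltr0n.
have p0 x j : 0 <= p j x by have [_ + _] := hp j.
have sk k' := net_weight_simplex R k' M0 : simplex K^-1 (net_weight R k').
have bD := bounded_log_ratio hp K1 (sk k) st.
have bV := bounded_measurable_expR (bounded_measurableZ 2^-1 bD).
set v := fun x => expR _ in bV *.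
have [mv _] := bV.
have v0 : 0 <= \int[mu]_x (pstar x * v x).
  by apply: Rintegral_ge0 => x _; have [_ ps0 _] := hps; rewrite mulr_ge0// expR_ge0.
(* The crude K replaces its square root because [iid_prod_tail] takes a natural number as bound. *)
have vK x : 0 <= v x <= K.
  rewrite expR_ge0/= -[leRHS]lnK ?posrE// ler_expR.
  have := @log_ratio_le _ _ _ p K K _ _ x (p0 x) K1 K0 (sk k) st
    (fun j => simplex_ratio j K0 (sk k) st).
  by have := ln_ge0 K1; lra.
have b0 : 0 < expR (- 2^-1) :> R by exact: expR_gt0.
have HP : forall w, A w -> expR (- 2^-1) <= \prod_i v (X i w).
  move=> w /HA kE; rewrite -expR_sum ler_expR -mulr_sumr.
  (* [k1] is the near-copy of [theta] in the net; passing to it costs at most ln (1 + 1/n) <= 1/n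
     per observation, hence at most 1 in total. *)
  have [k1 k1t] := net_weight_approx M0 n0 (simplex_weaken K0' st).
  have := argmax_ge k0 (net_score p) [tuple X i w | i < n] k1.
  rewrite kE /net_score.
  under eq_bigr do rewrite tnth_mktuple.
  under [X in _ <= X -> _]eq_bigr do rewrite tnth_mktuple.
  move=> H.
  have : \sum_(i < n) log_ratio p theta (net_weight R k1) (X i w) <= 1.
    rewrite -(mulfV (lt0r_neq0 n0')) -[n in n%:R * _]card_ord mulr_natl -sumr_const.
    apply: ler_sum => i _; apply: le_trans (ln1D_inv_le R n).
    by apply: (@log_ratio_le _ _ _ _ _ K) => //; rewrite lerDl invr_ge0 ltW.
  rewrite /log_ratio !sumrB; lra.
apply: (le_trans (iid_prod_tail n0 b0 hps iidX mv vK mA HP)).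
by rewrite lee_fin chernoff_arith.
Qed.

(** * Measurability of the selection, numerical constants and the union bound *)

Lemma measurable_net_score (R : realType) (d : measure_display)
    (T : measurableType d) (mu : {measure set T -> \bar R}) (M m n : nat)
    (p : 'I_M -> T -> R) (k : {ffun 'I_M -> 'I_m.+1}) :
    (0 < M)%N -> (forall j, density mu (p j)) ->
  measurable_fun setT (@net_score R T M m n p k).
Proof.
move=> M0 hp; apply: measurable_sum => i.
have c0 : 0 <= (M * m.+1)%:R^-1 :> R by rewrite invr_ge0.
have [mk _ _] := mix_density hp (simplex_weaken c0 (net_weight_simplex R k M0)).
apply: measurableT_comp => //; apply: measurableT_comp => //.
exact: measurable_tnth.
Qed.

Lemma measurable_selection (R : realType) (n : nat) (d d' : measure_display)
    (T : measurableType d) (Omega : measurableType d') (P : probability Omega R)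
    (X : 'I_n -> {RV P >-> T}) (I : finType) (i0 : I) (F : I -> n.-tuple T -> R)
    (Q : set I) : (forall i, measurable_fun setT (F i)) ->
  measurable [set w | Q (argmax i0 F [tuple X i w | i < n])].
Proof.
move=> mF.
have mX : measurable_fun setT (fun w => [tuple X i w | i < n]).
  apply/measurable_fun_tnthP => i; apply: (eq_measurable_fun (X i)) => //.
  by move=> w _ /=; rewrite tnth_mktuple.
rewrite -[X in measurable X]setTI.
exact: (mX measurableT _ (measurable_argmax i0 Q mF)).
Qed.

(** The constant 11/12 is 1 - 1/12, as 3 n M >= 12. The other two bounds are M (n M + 1) <= (3 n
    M)^2 and n M + 1 <= 3 n M. *)
Lemma net_size_constants (R : realType) (M n : nat) :
    (2 <= M)%N -> (2 <= n)%N ->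
    let L := ln (3 * n%:R * M%:R) : R in
  [/\ 11 / 12 <= L, ln (M * (n * M).+1)%:R <= 2 * L &
      #|{ffun 'I_M -> 'I_(n * M).+1}|%:R <= expR (M%:R * L)].
Proof.
move=> M2 n2 L.
have x12 : (12 <= 3 * n * M)%N.
  by rewrite -[12%N]/(3 * 2 * 2)%N leq_mul// leq_mul.
have LE : L = ln (3 * n * M)%:R by rewrite /L !natrM.
have x0 : 0 < (3 * n * M)%:R :> R by rewrite ltr0n (leq_trans _ x12).
have nM0 : (0 < n * M)%N by rewrite muln_gt0 !(leq_trans _ M2, leq_trans _ n2).
have nMx : ((n * M).+1 <= 3 * n * M)%N.
  by rewrite -mulnA mulSn -addn1 leq_add2l muln_gt0.
have eL : expR L = (3 * n * M)%:R by rewrite LE lnK.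
split.
- rewrite LE; apply: le_trans (ln_ge1BV x0).
  have : (3 * n * M)%:R^-1 <= 12^-1 :> R by rewrite lef_pV2 ?posrE// ler_nat.
  lra.
- rewrite LE mulr_natl -lnXn// ler_ln ?posrE ?exprn_gt0//.
    rewrite -natrX ler_nat expnS expn1 leq_mul// -mulnA mulnCA mulnA.
    by rewrite leq_pmull// muln_gt0 (leq_trans _ n2).
  by rewrite ltr0n muln_gt0 (leq_trans _ M2).
- rewrite card_ffun !card_ord expRM_natl eL natrX lerXn2r ?nnegrE ?ler0n//.
  by rewrite ler_nat.
Qed.

Theorem proposition4 (R : realType) (M n : nat) (delta : R)
    (d : measure_display) (T : measurableType d)
    (mu : {measure set T -> \bar R}) (p : 'I_M -> T -> R)
    (hM : (2 <= M)%N) (hn : (2 <= n)%N) (hdelta : 0 < delta < 1)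
    (hp : forall j, density mu (p j)) :
  exists2 phat : n.-tuple T -> T -> R, density_estimator mu phat &
    forall pstar : T -> R, density mu pstar ->
    forall (d' : measure_display) (Omega : measurableType d')
      (P : probability Omega R) (X : 'I_n -> {RV P >-> T}),
    iid_with_density mu pstar X ->
    let good := [set w : Omega |
      (KL mu pstar (phat [tuple X i w | i < n])
       <= ereal_inf [set KL mu pstar q | q in mixtures p]
          + ((43 * M%:R * ln (3 * n%:R * M%:R) ^+ 2
              + 22 * ln (3 * n%:R * M%:R) * ln (1 / delta)) / n%:R)%:E)%E] in
    measurable good /\ ((1 - delta)%:E <= P good)%E.
Proof.
have M0 : (0 < M)%N by exact: leq_trans hM.
have n0 : (0 < n)%N by exact: leq_trans hn.
have /andP[d0 d1] := hdelta.
have n0' : 0 < n%:R :> R by rewrite ltr0n.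
have [L1 KL2 NL] := net_size_constants R hM hn.
set L := ln (3 * n%:R * M%:R) in L1 KL2 NL *.
set K : R := (M * (n * M).+1)%:R in KL2.
have K1 : 1 <= K by rewrite ler1n muln_gt0 M0.
have K0 : 0 < K by exact: lt_le_trans K1.
have K0' : 0 <= K^-1 by rewrite invr_ge0 ltW.
pose k0 : {ffun 'I_M -> 'I_(n * M).+1} := [ffun=> ord0].
have mF k : measurable_fun setT (@net_score R T M (n * M) n p k).
  exact: measurable_net_score M0 hp.
exists (fun s => mix p (net_weight R (argmax k0 (net_score p) s))).
  apply: (@density_estimator_argmax _ _ _ mu n _ k0 (fun k => mix p (net_weight R k))) => // k.
  exact: mix_density hp (simplex_weaken K0' (net_weight_simplex R k M0)).
move=> pstar hps d' Omega P X iidX good.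
set V := ereal_inf _ in good *; set B := (_ / n%:R) in good *.
pose Q k := (KL mu pstar (mix p (@net_weight R M (n * M) k)) <= V + B%:E)%E.
have mgood : measurable good by exact: (measurable_selection X k0 [set k | Q k] mF).
split=> //.
(* With an infinite infimum every sample is good; otherwise some mixture has finite divergence, as
   [near_optimal_weights] requires. *)
have [Voo|] := eqVneq V +oo%E.
  rewrite (_ : good = setT) ?probability_setT ?lee_fin; first by lra.
  by apply/seteqP; split=> // w _; rewrite /good /= Voo addye// leey.
rewrite -ltey => /ereal_inf_lt[_ [q mixq <-] KLoo].
suff bad : (P (~` good) <= delta%:E)%E.
  move: bad; rewrite probability_setC// -(@fineK _ (P good)) ?fin_num_measure//.
  by rewrite -EFinB !lee_fin; lra.
pose k : R := (2 * n%:R)^-1.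
have k_gt0 : 0 < k by rewrite invr_gt0 mulr_gt0.
have kle : k <= 4^-1.
  rewrite lef_pV2 ?posrE ?mulr_gt0//.
  by have : 2 <= n%:R :> R by [rewrite ler_nat]; lra.
(* With e = l^2 the error e / l + 2 l K^2 of [near_optimal_likelihood_ratio] becomes l (1 + 2 K^2),
   which this choice makes equal to k. *)
pose l := k / (1 + 2 * K ^+ 2).
have KK : 0 < 1 + 2 * K ^+ 2 by have := sqr_ge0 K; lra.
have l_gt0 : 0 < l by rewrite divr_gt0.
have lk : l * (1 + 2 * K ^+ 2) = k by rewrite /l divfK// gt_eqF.
have lk1 : l <= k.
  by rewrite -lk ler_peMr ?(ltW l_gt0)//; have := sqr_ge0 K; lra.
have [theta [st opt KLle]] :=
  near_optimal_weights M0 n0 (exprn_gt0 2 l_gt0) hps hp mixq KLoo.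
pose A k := [set w | argmax k0 (net_score p) [tuple X i w | i < n] = k].
have mA k' : measurable (A k') by exact: (measurable_selection X k0 [set k'] mF).
apply: (@le_trans _ _ (\sum_(k' | ~~ `[< Q k' >]) P (A k'))%E).
  apply: measure_le_sum => //; first exact: measurableC.
  move=> w /= nQ; exists (argmax k0 (net_score p) [tuple X i w | i < n]) => //.
  exact/asboolPn.
set N : R := #|_|%:R in NL.
have N0 : 0 < N by rewrite ltr0n card_ffun !card_ord expn_gt0.
apply: (@le_trans _ _ (\sum_(k' | ~~ `[< Q k' >]) (delta / N)%:E)%E).
  apply: lee_sum => k' /asboolPn bad.
  have sk := net_weight_simplex R k' M0 : simplex K^-1 (net_weight R k').
  apply: (le_trans (net_selection_prob M0 n0 hps hp iidX st (mA k') (fun=> id))).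
  rewrite lee_fin; set v := \int[mu]_x _.
  have ratio := @near_optimal_likelihood_ratio _ _ _ mu _ p pstar K l (l ^+ 2) _ _
    hps hp K1 _ st sk opt.
  (* The choice a = 8 L is admissible: 4 ln K <= 8 L, and 8 L >= 22/3 > 5. *)
  have := excess_risk_le (a := 8 * L) (k := k) hps hp K1 st sk _ _ _.
  rewrite -/v => excess.
  (* A bad mixture has excess risk over [theta] above B - 2/n: one 1/n comes from smoothing and the
     other bounds the slack l^2. *)
  have {}excess : B - 2 * n%:R^-1 <= 2 * (8 * L) * (1 - v) + (8 * L - 1) * k.
    apply: (le_trans (y := - \int[mu]_x (pstar x * log_ratio p (net_weight R k') theta x)));
      last first.
      apply: excess; [lra|lra|apply: (le_trans (ratio _))].
        by rewrite l_gt0/=; lra.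
      by rewrite expr2 mulfK ?gt_eqF//; lra.
    have KLk := KLle _ sk; rewrite leNgt; apply/negP => lt; apply: bad.
    apply: (le_trans KLk); rewrite leeD2l// lee_fin.
    (* With all three weights equal this reads x = x - x, so x = 0; hence exchanging the two
       mixtures negates the expected log-ratio. *)
    have lr0 := integral_log_ratio_sub hps hp K1 sk sk sk.
    rewrite (integral_log_ratio_sub hps hp K1 sk st sk).
    have : l ^+ 2 <= n%:R^-1.
      have kn : k <= n%:R^-1 by rewrite lef_pV2 ?posrE ?mulr_gt0//; lra.
      by rewrite expr2; nra.
    lra.
  have ld0 : 0 <= ln (1 / delta) by rewrite ln_ge0// div1r invf_ge1// ltW.
  have := bound_arith hM n0 L1 ld0 excess erefl.
  rewrite div1r lnV ?posrE// => arith.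
  (* The exponential is delta exp (- M L), at most delta / N by the bound on the net size. *)
  apply: (le_trans (y := expR (ln delta - M%:R * L))).
    by rewrite ler_expR; lra.
  rewrite expRD lnK ?posrE// ler_pM2l// expRN lef_pV2 ?posrE ?expR_gt0//.
apply: (le_trans (y := (\sum_(k' : {ffun 'I_M -> 'I_(n * M).+1}) (delta / N)%:E)%E)).
  rewrite sumEFin sumEFin lee_fin [leRHS](bigID (fun k' => ~~ `[< Q k' >]))/= lerDl.
  by apply: sumr_ge0 => _ _; rewrite divr_ge0 ?ltW.
rewrite sumEFin lee_fin sumr_const -mulr_natr.
by rewrite divfK// gt_eqF.
Qed.
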